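(* Let $q$ be a power of an odd prime with $q\equiv 3\pmod 4$, and let $d\equiv 1\pmod 4$ be a positive integer. Let $P\subset\mathbb{F}_q^d$ be a set of points and $S$ a set of spheres in $\mathbb{F}_q^d$ all of whose radii are non-squares in $\mathbb{F}_q$. If $|P|\le N$ and $|S|\le N$, then \[ I(P,S)\ll q^{-1}N^2+q^{\frac{d-1}{2}}N. \]
   Context: A sphere in $\mathbb{F}_q^d$ with center $c\in\mathbb{F}_q^d$ and radius $r\in\mathbb{F}_q$ is $\{x : \sum_{i=1}^d (x_i-c_i)^2=r\}$; spheres are indexed by (center, radius). A radius $r$ is a non-square if $r\neq 0$ and $r\ne t^2$ for all $t\in\mathbb{F}_q$. $I(P,S)=\#\{(p,s)\in P\times S : p\in s\}$. $X\ll Y$ means $X\le CY$ for an absolute constant $C>0$. *)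

(* Defs.v *)
From mathcomp Require Import all_boot all_order all_algebra all_field.
Set Implicit Arguments. Unset Strict Implicit. Unset Printing Implicit Defensive.
Import Order.TTheory GRing.Theory Num.Theory.
Local Open Scope ring_scope.

Definition on_sphere (F : finFieldType) (d : nat)
  (x : 'rV[F]_d) (s : 'rV[F]_d * F) : bool :=
  (\sum_(i < d) (x ord0 i - s.1 ord0 i) ^+ 2) == s.2.

Definition nonsquare (F : finFieldType) (r : F) : bool :=
  (r != 0) && [forall t : F, r != t ^+ 2].

Definition incidences (F : finFieldType) (d : nat)
  (P : {set 'rV[F]_d}) (S : {set 'rV[F]_d * F}) : nat :=
  #|[set ps in setX P S | on_sphere ps.1 ps.2]|.

(* Main.v *)
(** Writing [-r = w^2] for a nonsquare radius [r] ([-1] is a nonsquare), a point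
    [p] and a sphere [(c, r)] are incident iff the vectors [(p, 0)] and [(c, w)]
    of [F^(d+1)] are at isotropic distance: [|p - c|^2 + w^2 = 0].  Put
    [D = d + 1], which is [2] modulo [4], so that Gauss sums satisfy
    [gauss s ^ D = - q^(D/2)] for all [s != 0].  Then the matrix
    [M = (q [|x - y|^2 = 0] - 1)_(x, y)] satisfies
    [(M - th)(M + (q - 1) th) = 0] with [th = q^(D/2)], that is
    [(M - th)^2 = q th (th - M)]; hence [M <= th] as quadratic forms, and it
    remains to evaluate [M] on the indicator of all the lifted vectors. *)
Require Import Defs.
From mathcomp Require Import all_boot all_order all_algebra all_field.
From mathcomp Require Import fingroup cyclic classfun character ring zify.
Import Order.TTheory GRing.Theory Num.Theory.
Local Open Scope ring_scope.

(** * A nontrivial additive character of a finite field *)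

Lemma exists_nontrivial_additive_char (F : finFieldType) :
  exists psi : F -> algC,
    [/\ psi 0 = 1, {morph psi : x y / x + y >-> x * y} & exists a, psi a != 1].
Proof.
pose G : {group F} := [set: F]%G.
have abG : abelian G by apply/centsP=> x _ y _; apply: addrC.
have ltG : (1 < Nirr G)%N.
  by rewrite -[Nirr G]card_ord (card_Iirr_abelian abG) cardsT finNzRing_gt1.
(* Index 0 is the principal character, so index 1 is a nontrivial one, and it is linear because the
   additive group is abelian. *)
pose i : Iirr G := Ordinal ltG.
have linI : 'chi_i \is a linear_char by apply/char_abelianP.
exists (fun x => 'chi_i x); split.
- exact: lin_char1.
- by move=> x y; rewrite -(lin_charM linI) ?inE.
have nt : 'chi_i != 1 by rewrite irr_eq1.
have [a Ha|all1] := pickP (fun a : F => 'chi_i a != 1); first by exists a.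
case/eqP: nt; apply/cfunP=> x; rewrite cfun1E inE.
exact/eqP/negbFE/all1.
Qed.

(** * Squares in a field with [q] congruent to 3 modulo 4 *)

Section CardThreeModFour.

Variable F : finFieldType.
Hypothesis cardF3 : (#|F| %% 4 = 3)%N.

Local Notation q := #|F|.

Lemma two_neq0 : (2%:R : F) != 0.
Proof.
apply/eqP=> two0; have := expg_cardG (in_setT (1 : F)).
rewrite cardsT FinRing.zmodXgE (divn_eq q 4) cardF3 => /eqP.
have -> : (q %/ 4 * 4 + 3 = 2 * (q %/ 4 * 2 + 1) + 1)%N by lia.
by rewrite natrD natrM two0 mul0r add0r oner_eq0.
Qed.

(** The exponent is [(q - 1) / 2], so the power squares to [x ^+ (q - 1) = 1]. *)
Lemma expf_half_card (x : F) : x != 0 ->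
  x ^+ (q %/ 4 * 2 + 1) = 1 \/ x ^+ (q %/ 4 * 2 + 1) = -1.
Proof.
move=> x0; have: x ^+ (q %/ 4 * 2 + 1) ^+ 2 == 1.
  rewrite -exprM -(inj_eq (mulfI x0)) mulr1 -exprS.
  have -> : (((q %/ 4 * 2 + 1) * 2).+1 = q)%N by rewrite [RHS](divn_eq q 4) cardF3; lia.
  by rewrite expf_card.
by rewrite sqrf_eq1 => /orP[]/eqP; [left|right].
Qed.

(** Since [(q - 1) / 2] is odd, [x ^+ 2 = -1] would give [x = x ^+ q = - x], hence [x = 0]. *)
Lemma sqr_neqN1 (x : F) : x ^+ 2 != -1.
Proof.
apply/eqP=> x2; have := expf_card x.
rewrite (divn_eq q 4) cardF3.
have -> : (q %/ 4 * 4 + 3 = (2 * (q %/ 4 * 2 + 1)).+1)%N by lia.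
rewrite exprS exprM x2 -signr_odd oddD oddM andbF /= expr1 mulrN1 => /eqP.
rewrite -subr_eq0 -opprD oppr_eq0 -mulr2n -mulr_natl mulf_eq0 (negPf two_neq0) /=.
by move=> /eqP x0; move/eqP: x2; rewrite x0 expr0n /= eq_sym oppr_eq0 oner_eq0.
Qed.

(** The witness [r ^+ ((q + 1) / 4)] has square [r] or [- r], and the first is excluded. *)
Lemma nonsquare_oppr_sqr (r : F) : nonsquare r -> exists2 w, w != 0 & w ^+ 2 = - r.
Proof.
case/andP=> r0 /forallP nsq; exists (r ^+ (q %/ 4 + 1)); first by rewrite expf_neq0.
have E : (r ^+ (q %/ 4 + 1)) ^+ 2 = r * r ^+ (q %/ 4 * 2 + 1).
  by rewrite -exprM -exprS; congr (_ ^+ _); lia.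
case: (expf_half_card _ r0) E => -> ; rewrite ?mulr1 ?mulrN1 // => E.
by have := nsq (r ^+ (q %/ 4 + 1)); rewrite E eqxx.
Qed.

(* A bijection of [F] that agrees with [x ^+ 2] up to sign. *)
Definition signed_sqr (x : F) := x ^+ (q %/ 4 * 2 + 1) * x ^+ 2.

Lemma signed_sqrP (x : F) : signed_sqr x = x ^+ 2 \/ signed_sqr x = - x ^+ 2.
Proof.
rewrite /signed_sqr; have [->|x0] := eqVneq x 0.
  by left; rewrite (expr0n _ 2) mulr0.
by case: (expf_half_card _ x0) => ->; [left|right]; rewrite ?mul1r ?mulN1r.
Qed.

Lemma signed_sqrN (x : F) : signed_sqr (- x) = - signed_sqr x.
Proof.
rewrite /signed_sqr sqrrN exprNn -signr_odd oddD oddM andbF /=.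
by rewrite expr1 mulN1r mulNr.
Qed.

Lemma signed_sqr_eq0 (x : F) : (signed_sqr x == 0) = (x == 0).
Proof. by rewrite /signed_sqr -exprD expf_eq0 addn2. Qed.

(** Equal values force [x ^+ 2 = y ^+ 2] up to sign. The minus sign would make [-1] a square, and
    [x = - y] contradicts oddness unless [y = 0]. *)
Lemma signed_sqr_inj : injective signed_sqr.
Proof.
move=> x y Exy; have [y0|y0] := eqVneq y 0.
  by apply/eqP; rewrite y0 -signed_sqr_eq0 Exy signed_sqr_eq0 y0.
have : (x ^+ 2 == y ^+ 2) || (x ^+ 2 == - y ^+ 2).
  case: (signed_sqrP x) (signed_sqrP y) Exy => -> [] -> E; apply/orP.
  - by left; apply/eqP.
  - by right; apply/eqP.
  - by right; rewrite -E opprK.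
  - by left; apply/eqP/oppr_inj.
case/orP.
  rewrite eqf_sqr => /orP[/eqP //|/eqP xNy]; move/eqP: Exy.
  rewrite xNy signed_sqrN eq_sym -subr_eq0 opprK -mulr2n -mulr_natl mulf_eq0.
  by rewrite (negPf two_neq0) signed_sqr_eq0 (negPf y0).
move/eqP=> E; have /eqP[] := sqr_neqN1 (x / y).
by rewrite expr_div_n E mulNr divff // expf_neq0.
Qed.

(** * Character sums and quadratic Gauss sums *)

Section Character.

Variable psi : F -> algC.
Hypothesis psi0 : psi 0 = 1.
Hypothesis psiD : {morph psi : x y / x + y >-> x * y}.
Hypothesis psi_nontrivial : exists a, psi a != 1.

Lemma additive_char_sum (a : F) : \sum_x psi (a * x) = (a == 0)%:R * q%:R.
Proof.
have [->|a0] := eqVneq a 0.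
  under eq_bigr do rewrite mul0r psi0.
  by rewrite sumr_const mul1r.
rewrite mul0r; have -> : \sum_x psi (a * x) = \sum_x psi x.
  by rewrite [RHS](reindex_inj (mulfI a0)).
have [b b1] := psi_nontrivial.
(* Translation by [b] multiplies the full sum by [psi b != 1], so the sum vanishes. *)
apply/eqP; have: psi b * \sum_x psi x == \sum_x psi x.
  rewrite [X in _ == X](reindex_inj (addrI b)) mulr_sumr.
  by under [X in _ == X]eq_bigr do rewrite psiD.
by rewrite -{2}[\sum_x psi x]mul1r -subr_eq0 -mulrBl mulf_eq0 subr_eq0 (negPf b1).
Qed.

Definition gauss (s : F) : algC := \sum_x psi (s * x ^+ 2).

(** In [gauss s + gauss (- s)] both signs of [x ^+ 2] occur, so it may be replaced by the bijection
    [signed_sqr], leaving two vanishing full character sums. *)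
Lemma gaussN (s : F) : s != 0 -> gauss (- s) = - gauss s.
Proof.
move=> s0; apply/eqP; rewrite -subr_eq0 opprK /gauss -big_split /=.
have -> : \sum_x (psi (- s * x ^+ 2) + psi (s * x ^+ 2))
   = \sum_x (psi (- s * signed_sqr x) + psi (s * signed_sqr x)).
  apply: eq_bigr => x _; case: (signed_sqrP x) => -> //.
  by rewrite mulrNN mulrN mulNr addrC.
rewrite big_split /= -!(reindex_inj signed_sqr_inj (P := xpredT) (F := fun y => psi (_ * y))) /=.
by rewrite !additive_char_sum oppr_eq0 (negPf s0) mul0r addr0.
Qed.

Lemma gauss_sqr (s : F) : s != 0 -> gauss s ^+ 2 = - q%:R.
Proof.
move=> s0; suff E : gauss s * gauss (- s) = q%:R.
  by rewrite -E gaussN // mulrN opprK.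
rewrite /gauss mulr_suml.
(* With [y = x + h] the exponent is linear in [x], so only [h = 0] survives the sum over [x]. *)
have -> : \sum_x psi (s * x ^+ 2) * (\sum_y psi (- s * y ^+ 2)) =
  \sum_x \sum_h psi (- s * h ^+ 2) * psi (- 2%:R * s * h * x).
  apply: eq_bigr => x _; rewrite (reindex_inj (addrI x)) mulr_sumr.
  by apply: eq_bigr => h _; rewrite -!psiD; congr psi; ring.
rewrite exchange_big /= (bigD1 0) //= [X in _ + X]big1 => [|h h0].
  rewrite -mulr_sumr additive_char_sum mulr0 eqxx mul1r expr0n mulr0 psi0.
  by rewrite mul1r addr0.
rewrite -mulr_sumr additive_char_sum !mulf_eq0 oppr_eq0 (negPf two_neq0).
by rewrite (negPf s0) (negPf h0) mul0r mulr0.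
Qed.

Lemma additive_char_prod (I : finType) (f : I -> F) :
  psi (\sum_i f i) = \prod_i psi (f i).
Proof. exact: (big_morph psi psiD psi0). Qed.

Lemma gauss_conv_cancel (s m : F) : s != 0 ->
  \sum_a psi (s * a ^+ 2 + - s * (m - a) ^+ 2) = (m == 0)%:R * q%:R.
Proof.
move=> s0; have -> : \sum_a psi (s * a ^+ 2 + - s * (m - a) ^+ 2) =
  \sum_a psi (- s * m ^+ 2) * psi (2%:R * s * m * a).
  by apply: eq_bigr => a _; rewrite -psiD; congr psi; ring.
rewrite -mulr_sumr additive_char_sum !mulf_eq0 (negPf two_neq0) (negPf s0) /=.
by have [->|] := eqVneq m 0; rewrite ?expr0n ?mulr0 ?psi0 ?mul1r // !mul0r mulr0.
Qed.

(** Complete the square, with centre [t * m / (s + t)]. *)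
Lemma gauss_conv (s t m : F) : s + t != 0 ->
  \sum_a psi (s * a ^+ 2 + t * (m - a) ^+ 2) =
  psi (s * t / (s + t) * m ^+ 2) * gauss (s + t).
Proof.
move=> st0; rewrite (reindex_inj (addrI (t * m / (s + t)))) mulr_sumr.
by apply: eq_bigr => a _; rewrite -psiD; congr psi; field.
Qed.

(** * Convolution of quadratic characters in several variables *)

Variable I : finType.

Definition sqnorm (x : {ffun I -> F}) : F := \sum_i x i ^+ 2.

Lemma additive_char_sqnorm_conv (s t : F) (m : {ffun I -> F}) :
  \sum_z psi (s * sqnorm z + t * sqnorm (m - z)) =
  \prod_i \sum_a psi (s * a ^+ 2 + t * (m i - a) ^+ 2).
Proof.
rewrite bigA_distr_bigA; apply: eq_bigr => z _.
rewrite /sqnorm !mulr_sumr -big_split additive_char_prod.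
by apply: eq_bigr => i _; rewrite !ffunE.
Qed.

Lemma sqnorm_conv_cancel (s : F) (m : {ffun I -> F}) : s != 0 ->
  \sum_z psi (s * sqnorm z + - s * sqnorm (m - z)) =
  (m == 0)%:R * q%:R ^+ #|I|.
Proof.
move=> s0; rewrite additive_char_sqnorm_conv.
under eq_bigr do rewrite gauss_conv_cancel //.
have [->|] := eqVneq m 0.
  by under eq_bigr do rewrite ffunE eqxx mul1r; rewrite prodr_const mul1r.
move=> /eqP nz; rewrite mul0r; apply/eqP/prodf_eq0.
have [i mi|m0] := pickP (fun i => m i != 0).
  by exists i; rewrite // (negPf mi) mul0r.
by case: nz; apply/ffunP=> i; rewrite ffunE; apply/eqP/negbFE/m0.
Qed.

Hypothesis cardI2 : (#|I| %% 4 = 2)%N.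

(** The sum factors over coordinates. As [#|I|] is twice an odd number, the Gauss sums multiply to
    an odd power of [- q], whence the sign. *)
Lemma sqnorm_conv (s t : F) (m : {ffun I -> F}) : s + t != 0 ->
  \sum_z psi (s * sqnorm z + t * sqnorm (m - z)) =
  - q%:R ^+ (#|I| %/ 2) * psi (s * t / (s + t) * sqnorm m).
Proof.
move=> st0; rewrite additive_char_sqnorm_conv.
under eq_bigr do rewrite gauss_conv //.
rewrite big_split /= -additive_char_prod -mulr_sumr prodr_const mulrC.
congr (_ * _); rewrite {1}(_ : #|I| = 2 * (#|I| %/ 4 * 2 + 1))%N; last lia.
rewrite exprM gauss_sqr // (_ : #|I| %/ 2 = #|I| %/ 4 * 2 + 1)%N; last lia.
by rewrite exprNn -signr_odd oddD oddM andbF expr1 mulN1r.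
Qed.

(** Subtracting 1 removes the trivial frequency from the Fourier expansion of the indicator of 0,
    scaled by [q]. *)
Definition zero_kernel (t : F) : int := q%:R * (t == 0)%:R - 1.

Lemma zero_kernelE (t : F) :
  (zero_kernel t)%:~R = \sum_(s | s != 0) psi (s * t) :> algC.
Proof.
have E : \sum_s psi (s * t) = (t == 0)%:R * q%:R.
  by rewrite -additive_char_sum; apply: eq_bigr => s _; rewrite mulrC.
move: E; rewrite (bigD1 0) //= mul0r psi0 => E.
rewrite /zero_kernel rmorphB rmorphM /= rmorph1 !rmorph_nat mulrC -E; ring.
Qed.

(* [t |-> s t / (s + t)], i.e. [1/u = 1/s + 1/t], is a bijection from
   [t != 0, - s] to [u != 0, s]. *)
Lemma additive_char_sum_harmonic (s M : F) : s != 0 ->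
  \sum_(t | (t != 0) && (t != - s)) psi (s * t / (s + t) * M) =
  \sum_(u | u != 0) psi (u * M) - psi (s * M).
Proof.
move=> s0; rewrite [X in _ = X - _](bigD1 s) //= [X in _ = X]addrC addKr.
rewrite (reindex_onto (fun u => s * u / (s - u)) (fun t => s * t / (s + t))) /=.
  apply: eq_big => [u|u /andP[/andP[u0 us] /eqP->] //].
  have [->|su] := eqVneq u s.
    by rewrite subrr invr0 mulr0 eqxx andbF.
  have su0 : s - u != 0 by rewrite subr_eq0 eq_sym.
  rewrite !mulf_eq0 invr_eq0 (negPf s0) (negPf su0) orbF /= andbT.
  have -> : s * u / (s - u) != - s.
    rewrite -subr_eq0 opprK.
    have -> : s * u / (s - u) + s = s ^+ 2 / (s - u) by field.
    by rewrite mulf_neq0 ?invr_eq0 ?expf_neq0.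
  rewrite andbT; have -> : s * (s * u / (s - u)) / (s + s * u / (s - u)) = u.
    have -> : s + s * u / (s - u) = s ^+ 2 / (s - u) by field.
    by field; rewrite su0 s0.
  by rewrite eqxx andbT.
move=> t /andP[t0 ts].
have st0 : s + t != 0 by rewrite addrC -[s]opprK subr_eq0.
have -> : s - s * t / (s + t) = s ^+ 2 / (s + t) by field.
by field; rewrite st0 s0.
Qed.

(** This is the quadratic equation of the matrix [M], read entrywise: [m] is the difference of the
    two indices. Both kernels are expanded in characters, so the integer identity is checked in
    [algC]. *)
Lemma zero_kernel_conv_char (m : {ffun I -> F}) :
  \sum_z zero_kernel (sqnorm z) * zero_kernel (sqnorm (m - z)) =
  - (q%:R - 2%:R) * q%:R ^+ (#|I| %/ 2) * zero_kernel (sqnorm m)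
  + (q%:R - 1) * q%:R ^+ #|I| * (m == 0)%:R.
Proof.
apply: (@intr_inj algC); rewrite rmorph_sum /=.
have -> : \sum_z (zero_kernel (sqnorm z) * zero_kernel (sqnorm (m - z)))%:~R =
  \sum_(s | s != 0) \sum_(t | t != 0)
    \sum_z psi (s * sqnorm z + t * sqnorm (m - z)) :> algC.
  under eq_bigr do rewrite rmorphM /= !zero_kernelE big_distrlr /=.
  rewrite exchange_big /=; apply: eq_bigr => s _.
  rewrite exchange_big /=; apply: eq_bigr => t _.
  by apply: eq_bigr => z _; rewrite psiD.
have E (s : F) : s != 0 ->
  \sum_(t | t != 0) \sum_z psi (s * sqnorm z + t * sqnorm (m - z)) =
  (m == 0)%:R * q%:R ^+ #|I| - q%:R ^+ (#|I| %/ 2) *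
   ((zero_kernel (sqnorm m))%:~R - psi (s * sqnorm m)).
  (* The frequency [t = - s] yields the identity matrix; the others recombine into [M] minus one
     character. *)
  move=> s0; rewrite (bigD1 (- s)) ?oppr_eq0 //= sqnorm_conv_cancel //.
  congr (_ + _); rewrite zero_kernelE -additive_char_sum_harmonic // mulr_sumr -sumrN.
  apply: eq_bigr => t /andP[_ ts]; rewrite -mulNr; apply: sqnorm_conv.
  by rewrite addrC -[s]opprK subr_eq0.
rewrite (eq_bigr _ E) sumrB sumr_const -mulr_sumr sumrB -zero_kernelE sumr_const.
have -> : #|[pred s : F | s != 0]| = q.-1.
  by rewrite (cardC1 0).
have -> : q.-1 = (q - 1)%N by lia.
have q1 : (1 <= q)%N by lia.
rewrite !(rmorphD, rmorphM, rmorphN, rmorphXn, rmorph_nat, rmorph1) /=.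
rewrite -[_ *+ (q - 1)]mulr_natl -[K in _ - _ * (K - _)]mulr_natl natrB //.
ring.
Qed.

End Character.

(** * Quadratic form bound and isotropic pairs *)

Lemma zero_kernel_conv (I : finType) (cardI2 : (#|I| %% 4 = 2)%N)
    (m : {ffun I -> F}) :
  \sum_z zero_kernel (sqnorm I z) * zero_kernel (sqnorm I (m - z)) =
  - (q%:R - 2%:R) * q%:R ^+ (#|I| %/ 2) * zero_kernel (sqnorm I m)
  + (q%:R - 1) * q%:R ^+ #|I| * (m == 0)%:R.
Proof.
have [psi [psi0 psiD psi_nt]] := exists_nontrivial_additive_char F.
exact: zero_kernel_conv_char psi psi0 psiD psi_nt I cardI2 m.
Qed.

Lemma zero_kernel_sum_le (I : finType) (cardI2 : (#|I| %% 4 = 2)%N)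
    (E : {set {ffun I -> F}}) :
  \sum_(x in E) \sum_(y in E) zero_kernel (sqnorm I (x - y)) <=
  q%:R ^+ (#|I| %/ 2) * #|E|%:R.
Proof.
set T := \sum_(x in E) _; set th : int := q%:R ^+ _.
have thI : q%:R ^+ #|I| = th ^+ 2.
  by rewrite /th -exprM; congr (_ ^+ _); lia.
have q0 : 0 < q%:R :> int by rewrite ltr0n; lia.
have th0 : 0 < th by apply: exprn_gt0.
pose k (x y : {ffun I -> F}) := zero_kernel (sqnorm I (x - y)).
have kC x y : k x y = k y x.
  rewrite /k /sqnorm; congr zero_kernel; apply: eq_bigr => i _.
  by rewrite -sqrrN !ffunE opprB.
(* The entry of [M ^ 2] at [(y, y')], by translation invariance and symmetry of [k]. *)
have conv y y' : \sum_x k x y * k x y' =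
    - (q%:R - 2%:R) * th * k y y' + (q%:R - 1) * th ^+ 2 * (y == y')%:R.
  have := zero_kernel_conv I cardI2 (y' - y); rewrite thI subr_eq0 eq_sym -/th.
  rewrite -/(k y' y) kC => <-; rewrite (reindex_inj (addIr y)) /=.
  apply: eq_bigr => z _; rewrite (kC _ y') /k addrK; congr (_ * zero_kernel (sqnorm I _)).
  by rewrite opprD addrA addrAC.
have sumE : \sum_x (x \in E)%:R = #|E|%:R :> int.
  by rewrite -natr_sum -sum1_card [in RHS]big_mkcond; congr _%:R; apply: eq_bigr => x _; case: ifP.
pose g x := \sum_(y in E) k x y.
have TE : T = \sum_x g x * (x \in E)%:R.
  by rewrite /T big_mkcond; apply: eq_bigr => x _; case: (x \in E); rewrite ?mulr1 ?mulr0.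
(* This is the squared norm of [M - th] applied to the indicator of [E]; the equation for [M]
   evaluates it, and its sign bounds [T]. *)
have : 0 <= \sum_x (g x - th * (x \in E)%:R) ^+ 2.
  by apply: sumr_ge0 => x _; apply: sqr_ge0.
have -> : \sum_x (g x - th * (x \in E)%:R) ^+ 2 = q%:R * th * (th * #|E|%:R - T).
  have -> : \sum_x (g x - th * (x \in E)%:R) ^+ 2 =
      \sum_x g x * g x - 2%:R * th * T + th ^+ 2 * #|E|%:R.
    rewrite -sumE TE !mulr_sumr -sumrB -big_split /=.
    by apply: eq_bigr => x _; case: (x \in E); rewrite ?mulr1 ?mulr0 ?subr0 ?addr0 ?expr2 //; ring.
  have -> : \sum_x g x * g x =
      - (q%:R - 2%:R) * th * T + (q%:R - 1) * th ^+ 2 * #|E|%:R.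
    under eq_bigr do rewrite /g big_distrlr /=.
    rewrite exchange_big /= -sumE [X in _ = _ + _ * X](bigID (mem E)) /=.
    rewrite [X in _ = _ + _ * (_ + X)]big1 => [|x /negPf-> //]; rewrite addr0.
    rewrite /T !mulr_sumr -big_split /=; apply: eq_bigr => y Ey.
    rewrite exchange_big /= Ey; under eq_bigr do rewrite conv.
    rewrite big_split /= -mulr_sumr -mulr_sumr; congr (_ + _ * _).
    rewrite (bigD1 y) //= eqxx big1 ?addr0 // => z /andP[_ zy].
    by rewrite eq_sym (negPf zy).
  by ring.
by rewrite pmulr_rge0 ?mulr_gt0 // subr_ge0.
Qed.

Lemma isotropic_pairs_bound (I : finType) (cardI2 : (#|I| %% 4 = 2)%N)
    (E : {set {ffun I -> F}}) :
  (q * #|[set xy in setX E E | sqnorm I (xy.1 - xy.2)%R == 0%R]| <=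
   #|E| ^ 2 + q ^ (#|I| %/ 2) * #|E|)%N.
Proof.
have := zero_kernel_sum_le I cardI2 E.
have -> : \sum_(x in E) \sum_(y in E) zero_kernel (sqnorm I (x - y)) =
  q%:R * #|[set xy in setX E E | sqnorm I (xy.1 - xy.2) == 0]|%:R - (#|E| ^ 2)%:R.
  rewrite pair_big /= sumrB -mulr_sumr sumr_const; congr (_ * _ - _%:R).
    rewrite -sum1_card natr_sum [LHS]big_mkcond [RHS]big_mkcond.
    apply: eq_bigr => -[x y] _ /=.
    by rewrite !inE /=; case: (_ && _); case: eqP.
  by rewrite -mulnn -cardsX; apply: eq_card => -[x y]; rewrite !inE.
rewrite lerBlDl; move: (#|E|) (#|_|) => e c.
by rewrite -natrX -!natrM -natrD ler_nat.
Qed.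

End CardThreeModFour.

(** * Lifting points and spheres to dimension [d + 1] *)

Definition prepend_coord (F : finFieldType) (d : nat) (x : 'rV[F]_d) (w : F) :
  {ffun 'I_d.+1 -> F} :=
  [ffun i => if unlift ord0 i is Some j then x ord0 j else w].

Lemma prepend_coord_inj (F : finFieldType) (d : nat) (x y : 'rV[F]_d) (v w : F) :
  prepend_coord F d x v = prepend_coord F d y w -> x = y /\ v = w.
Proof.
move=> /ffunP E; split; last by have := E ord0; rewrite !ffunE unlift_none.
apply/rowP => j; have := E (lift ord0 j).
by rewrite !ffunE liftK.
Qed.

Lemma sqnorm_sub_prepend_coord (F : finFieldType) (d : nat) (x y : 'rV[F]_d) (w : F) :
  sqnorm F 'I_d.+1 (prepend_coord F d x 0 - prepend_coord F d y w) =
  \sum_(i < d) (x ord0 i - y ord0 i) ^+ 2 + w ^+ 2.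
Proof.
rewrite /sqnorm big_ord_recl !ffunE unlift_none sub0r sqrrN addrC.
by congr (_ + _); apply: eq_bigr => i _; rewrite !ffunE liftK.
Qed.

Lemma incidences_bound (F : finFieldType) (d : nat)
    (P : {set 'rV[F]_d}) (S : {set 'rV[F]_d * F}) (N : nat) :
  (#|F| %% 4 = 3)%N -> (d %% 4 = 1)%N ->
  (forall s, s \in S -> nonsquare s.2) -> (#|P| <= N)%N -> (#|S| <= N)%N ->
  (#|F| * incidences P S <=
   4 * N ^ 2 + 2 * (#|F| ^ ((d - 1) %/ 2).+1 * N))%N.
Proof.
move=> q3 d1 nsq PN SN.
(* The default 0 is never reached at a nonsquare radius. *)
pose root (r : F) := odflt 0 [pick w | (w != 0) && (w ^+ 2 == - r)].
have rootE r : nonsquare r -> root r ^+ 2 = - r.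
  move=> /(nonsquare_oppr_sqr F q3)[w w0 w2]; rewrite /root.
  by case: pickP => [v /andP[_ /eqP]//|/(_ w)]; rewrite w0 w2 eqxx.
pose fP (p : 'rV[F]_d) := prepend_coord F d p 0.
pose fS (s : 'rV[F]_d * F) := prepend_coord F d s.1 (root s.2).
pose E := (fP @: P) :|: (fS @: S).
have EN : (#|E| <= 2 * N)%N.
  rewrite mul2n -addnn (leq_trans (leq_card_setU _ _)) //.
  by rewrite leq_add // (leq_trans (leq_imset_card _ _)).
have I2 : (#|'I_d.+1| %% 4 = 2)%N by rewrite card_ord; lia.
have := isotropic_pairs_bound F q3 'I_d.+1 I2 E.
set A := [set xy in _ | _] => boundA.
have IA : (incidences P S <= #|A|)%N.
  (* Incidences inject into isotropic pairs: the added coordinate [w] of a lifted sphere recovers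
     its radius as [- w ^+ 2]. *)
  rewrite /incidences -(card_in_imset (f := fun ps => (fP ps.1, fS ps.2))).
    apply/subset_leq_card/subsetP => _ /imsetP[[p s] ps ->].
    move: ps; rewrite !inE /= => /andP[/andP[pP sS] /eqP ps].
    rewrite !imset_f ?orbT //= sqnorm_sub_prepend_coord ps rootE ?nsq //.
    by rewrite subrr.
  move=> [p s] [p' s']; rewrite !inE /=.
  move=> /andP[/andP[_ /nsq sS] _] /andP[/andP[_ /nsq sS'] _] [].
  move=> /prepend_coord_inj[-> _] /prepend_coord_inj[s1 s2]; congr (_, _).
  rewrite [s]surjective_pairing [s']surjective_pairing s1; congr (_, _).
  by apply: oppr_inj; rewrite -!rootE // s2.
apply: leq_trans (leq_trans (_ : _ <= #|F| * #|A|)%N boundA) _.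
  by rewrite leq_mul2l IA orbT.
have -> : (#|'I_d.+1| %/ 2 = ((d - 1) %/ 2).+1)%N by rewrite card_ord; lia.
apply: leq_add; first by rewrite -[4%N]/(2 ^ 2)%N -expnMn leq_sqr.
by rewrite mulnCA leq_mul2l EN orbT.
Qed.

Theorem theorem1p7 :
  exists C : rat, 0 < C /\
  forall (F : finFieldType) (d : nat),
    odd #|F| -> (#|F| %% 4 = 3)%N ->
    (0 < d)%N -> (d %% 4 = 1)%N ->
    forall (P : {set 'rV[F]_d}) (S : {set 'rV[F]_d * F}) (N : nat),
      (forall s, s \in S -> nonsquare s.2) ->
      (#|P| <= N)%N -> (#|S| <= N)%N ->
      (incidences P S)%:R
        <= C * ((N ^ 2)%:R / (#|F|)%:R + (#|F| ^ ((d - 1) %/ 2) * N)%:R).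
Proof.
(* The 4 comes from the square of [#|E| <= 2 * N] and absorbs the 2 of the linear term. Dividing by
   [q] lowers the exponent [(d + 1) / 2] to [(d - 1) / 2]. *)
exists 4%:R; split=> // F d _ q3 _ d1 P S N nsq PN SN.
have := incidences_bound F d P S N q3 d1 nsq PN SN.
have q0 : (0 < #|F|)%N by lia.
rewrite (expnS _ (_ %/ _)); move: (incidences P S) (#|F| ^ (_ %/ _))%N => i e bnd.
have q0R : 0 < #|F|%:R :> rat by rewrite ltr0n.
rewrite -(ler_pM2l q0R) mulrCA mulrDr mulrCA divff ?gt_eqF // mulr1.
rewrite -!natrM -natrD -natrM ler_nat (leq_trans bnd) //.
by rewrite mulnDr leq_add2l -mulnA leq_mul.
Qed.
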